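(* Let $0 \le \mu_i < L_i < \infty$ for all $i\in [m-1]$ and $0 \le \mu_m < L_m = \infty$. Given $m$ points $x_i^\star \in \mathbb{R}^n$, $i\in[m]$, a point $x^\star \in \mathbb{R}^n$ is a minimizer of the sum $\sum_{i=1}^m f_i(x)$ for some functions $f_i\in\mathcal{M}_{\mu_i,L_i}(x_i^\star)$, $i\in [m]$, if and only if $$\sum_{i\in [m-1]} \frac{L_i+\mu_i}{2} \langle x^\star-x_i^\star, x^\star-x_m^\star \rangle + \mu_m\| x^\star-x_m^\star\|^2 \leq \sum_{i\in [m-1]} \frac{L_i-\mu_i}{2}\| x^\star-x_i^\star\| \| x^\star-x_m^\star\|.$$
   Context: $[m]=\{1,\dots,m\}$. $\|\cdot\|$ and $\langle\cdot,\cdot\rangle$ are the Euclidean norm and dot product on $\mathbb{R}^n$. For a convex $f:\mathbb{R}^n\to(-\infty,\infty]$ and $x\in\mathrm{dom}\, f$, $\partial f(x)=\{g: f(y)\ge f(x)+\langle g,y-x\rangle\ \forall y\in\mathbb{R}^n\}$. A convex function $f$ is $L$-smooth ($L\in(0,\infty]$) if $\|g_1-g_2\|\le L\|x_1-x_2\|$ for all $x_1,x_2\in\mathbb{R}^n$, $g_1\in\partial f(x_1)$, $g_2\in\partial f(x_2)$; if $L<\infty$ this means $f$ is differentiable on $\mathbb{R}^n$ with $L$-Lipschitz gradient, and every convex function is regarded as $\infty$-smooth. $f$ is $\mu$-strongly convex ($\mu\ge 0$) if $x\mapsto f(x)-\frac{\mu}{2}\|x\|^2$ is convex. $\mathcal{F}_{\mu,L}(\mathbb{R}^n)$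 is the set of closed proper convex functions $\mathbb{R}^n\to(-\infty,\infty]$ that are $L$-smooth and $\mu$-strongly convex, and $\mathcal{M}_{\mu,L}(z)$ is the set of functions in $\mathcal{F}_{\mu,L}(\mathbb{R}^n)$ for which $z$ is a (global) minimizer. *)

(* Defs.v *)
From HB Require Import structures.
From mathcomp Require Import all_boot all_order all_algebra.
From mathcomp Require Import all_classical all_reals all_analysis.

Set Implicit Arguments.
Unset Strict Implicit.
Unset Printing Implicit Defensive.

Import Order.TTheory GRing.Theory Num.Theory.
Import numFieldNormedType.Exports.

Local Open Scope classical_set_scope.
Local Open Scope ring_scope.

Section ConvexClasses.
Context {R : realType} {n : nat}.
Implicit Types (x y z g : 'rV[R]_n) (f : 'rV[R]_n -> \bar R).

Definition dot x y : R := \sum_(i < n) x 0 i * y 0 i.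

(* The library norm `|x| on row vectors is the sup norm, hence this one. The
   library topology on 'rV[R]_n is the usual Euclidean topology. *)
Definition enorm x : R := Num.sqrt (dot x x).

Definition is_minimizer f x : Prop := forall y, (f x <= f y)%E.

Definition proper_fun f : Prop :=
  (forall x, (-oo < f x)%E) /\ (exists x, (f x < +oo)%E).

(* Only used for functions that never take the value -oo. Since 0 * +oo = 0 in
   \bar R, the cases t = 0 and t = 1 impose nothing. *)
Definition convex_fun f : Prop := forall x y (t : R), 0 <= t <= 1 ->
  (f (t *: x + (1 - t) *: y)%R <= t%:E * f x + (1 - t)%R%:E * f y)%E.

Definition closed_fun f : Prop :=
  closed [set p : 'rV[R]_n * R | (f p.1 <= p.2%:E)%E].

(* The subdifferential is empty outside the domain. *)
Definition subdiff f x : set 'rV[R]_n :=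
  [set g | (f x < +oo)%E /\ forall y, (f x + (dot g (y - x)%R)%:E <= f y)%E].

(* Every function is +oo-smooth. The case L = +oo has to be set apart: both
   fine +oo = 0 and +oo * 0 = 0 in \bar R would make it a real constraint. *)
Definition smooth (L : \bar R) f : Prop := (L < +oo)%E ->
  forall x1 x2 g1 g2, subdiff f x1 g1 -> subdiff f x2 g2 ->
    enorm (g1 - g2) <= fine L * enorm (x1 - x2).

Definition strongly_convex (mu : R) f : Prop :=
  convex_fun (fun x => (f x - (mu / 2 * enorm x ^+ 2)%R%:E)%E).

Definition classF (mu : R) (L : \bar R) : set ('rV[R]_n -> \bar R) :=
  [set f | [/\ proper_fun f, closed_fun f, convex_fun f, smooth L f
             & strongly_convex mu f]].

Definition classM (mu : R) (L : \bar R) z : set ('rV[R]_n -> \bar R) :=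
  [set f | classF mu L f /\ is_minimizer f z].

End ConvexClasses.

(* Main.v *)
Require Import Defs.
From mathcomp Require Import all_boot all_order all_algebra.
From mathcomp Require Import all_classical all_reals all_analysis.
From mathcomp Require Import ring lra.
Import Order.TTheory GRing.Theory Num.Theory.
Import numFieldNormedType.Exports.
Local Open Scope classical_set_scope.
Local Open Scope ring_scope.

(** Write d_i = x - xs_i, e = x - xs_m and l_i = L_i - mu_i.

    Everything rests on the set of gradients g that a function of class
    M_(mu_i, L_i)(xs_i) can have at x. Removing the quadratic
    mu_i/2 |y - xs_i|^2 leaves an l_i-smooth convex function, whose gradient h
    at x satisfies |h|^2 <= l_i <h, d_i> (cocoercivity, [cocoercive]). This says
    that g lies in the ball of center (L_i + mu_i)/2 d_i and radius
    (L_i - mu_i)/2 |d_i|, so the smallest possible value of <g, e> is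
    (L_i + mu_i)/2 <d_i, e> - (L_i - mu_i)/2 |d_i| |e|.
    For f_m the only constraint on a subgradient g is <g, e> >= mu_m |e|^2.
    The inequality of the theorem says precisely that these lower bounds leave
    room for gradients that sum to zero.

    Necessity ([minimizer_sum_necessary]). Moving from x towards xs_m, the first
    order change of the sum is at most - sum_(i < m) <g_i, e> - mu_m |e|^2: the
    smooth f_i are bounded above by the descent lemma ([descent]) and f_m by
    strong convexity on the segment.
    Smoothness is a condition on subgradients only, and one first has to show
    that it makes the f_i, i < m, finite and subdifferentiable everywhere
    ([smooth_subdiff]). This is obtained from proximal points of x, which exist
    by compactness, converge to x as the proximal weight grows, and carry
    subgradients that form a Cauchy sequence.

    Sufficiency ([minimizer_sum_sufficient]). The extreme point of the ball in
    the direction - e is the gradient at x of a quadratic with Hessian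
    mu_i I + l_i v v^T for a suitable v with |v| <= 1 ([quad_classM],
    [extremal_direction]). The gradient left over for f_m has the
    form mu_m e + h with <h, e> >= 0, and is a subgradient at x of
    mu_m/2 |y - xs_m|^2 + max(0, <h, y - x>) ([ramp_classM]). *)

(** * Euclidean geometry of row vectors *)

Section Euclid.
Context {R : realType} {n : nat}.
Implicit Types (x y z : 'rV[R]_n) (a b : R).

Lemma dotC x y : dot x y = dot y x.
Proof. by apply: eq_bigr => i _; rewrite mulrC. Qed.

Lemma dotDl x y z : dot (x + y) z = dot x z + dot y z.
Proof. by rewrite -big_split; apply: eq_bigr => i _; rewrite mxE mulrDl. Qed.

Lemma dotZl a x z : dot (a *: x) z = a * dot x z.
Proof. by rewrite /dot mulr_sumr; apply: eq_bigr => i _; rewrite mxE mulrA. Qed.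

Lemma dotDr x y z : dot z (x + y) = dot z x + dot z y.
Proof. by rewrite dotC dotDl !(dotC z). Qed.

Lemma dotZr a x z : dot z (a *: x) = a * dot z x.
Proof. by rewrite dotC dotZl (dotC z). Qed.

Lemma dotNl x z : dot (- x) z = - dot x z.
Proof. by rewrite -scaleN1r dotZl mulN1r. Qed.

Lemma dotNr x z : dot z (- x) = - dot z x.
Proof. by rewrite dotC dotNl dotC. Qed.

Lemma dot0l x : dot 0 x = 0.
Proof. by rewrite -(scale0r 0) dotZl mul0r. Qed.

Lemma dot0r x : dot x 0 = 0.
Proof. by rewrite dotC dot0l. Qed.

Definition dotE := (dotDl, dotDr, dotNl, dotNr, dotZl, dotZr, dot0l, dot0r).

Lemma dot_suml (I : Type) (r : seq I) (P : pred I) (v : I -> 'rV[R]_n) z :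
  dot (\sum_(i <- r | P i) v i) z = \sum_(i <- r | P i) dot (v i) z.
Proof.
by elim/big_rec2 : _ => [|i a b _ <-]; rewrite ?dot0l ?dotDl.
Qed.

Lemma dotxx_ge0 x : 0 <= dot x x.
Proof. by apply: sumr_ge0 => i _; rewrite -expr2 sqr_ge0. Qed.

Lemma dotxx_eq0 x : dot x x = 0 -> x = 0.
Proof.
move=> /eqP; rewrite psumr_eq0 => [/allP x0|i _]; last by rewrite -expr2 sqr_ge0.
apply/rowP => i; rewrite mxE; apply/eqP.
by have := x0 i (mem_index_enum i); rewrite mulf_eq0 orbb.
Qed.

Lemma enorm_ge0 x : 0 <= enorm x.
Proof. exact: sqrtr_ge0. Qed.

Lemma sqr_enorm x : enorm x ^+ 2 = dot x x.
Proof. by rewrite sqr_sqrtr// dotxx_ge0. Qed.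

Lemma enorm_eq0 x : enorm x = 0 -> x = 0.
Proof. by move=> x0; apply: dotxx_eq0; rewrite -sqr_enorm x0 expr0n. Qed.

Lemma enormZ a x : enorm (a *: x) = `|a| * enorm x.
Proof.
by rewrite /enorm dotZl dotZr mulrA -expr2 sqrtrM ?sqr_ge0// sqrtr_sqr.
Qed.

Lemma enormN x : enorm (- x) = enorm x.
Proof. by rewrite /enorm dotNl dotNr opprK. Qed.

Lemma enormB x y : enorm (x - y) = enorm (y - x).
Proof. by rewrite -enormN opprB. Qed.

Lemma cauchy_schwarz x y : dot x y <= enorm x * enorm y.
Proof.
have ex := enorm_ge0 x; have ey := enorm_ge0 y.
have [x0|x0] := eqVneq (enorm x) 0.
  by rewrite (enorm_eq0 _ x0) dot0l mulr_ge0 ?enorm_ge0.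
have [y0|y0] := eqVneq (enorm y) 0.
  by rewrite (enorm_eq0 _ y0) dot0r mulr_ge0 ?enorm_ge0.
have := dotxx_ge0 (enorm y *: x - enorm x *: y).
rewrite !dotE -!sqr_enorm (dotC y x) => h.
have p : 0 < enorm x * enorm y by rewrite mulr_gt0 ?lt0r ?x0 ?y0.
rewrite -(ler_pM2l p); nra.
Qed.

Lemma ler_enorm_sqr x a : 0 <= a -> (enorm x <= a) = (dot x x <= a ^+ 2).
Proof. by move=> a0; rewrite -sqr_enorm ler_pXn2r// nnegrE enorm_ge0. Qed.

Lemma enormD x y : enorm (x + y) <= enorm x + enorm y.
Proof.
rewrite ler_enorm_sqr ?addr_ge0 ?enorm_ge0//.
have := cauchy_schwarz x y; rewrite !dotE -!sqr_enorm (dotC y x); nra.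
Qed.

Lemma coord_le_enorm x i : `|x 0 i| <= enorm x.
Proof.
rewrite -(@ler_pXn2r _ 2) ?nnegrE ?enorm_ge0// sqr_enorm real_normK ?num_real//.
rewrite /dot (bigD1 i)//= expr2 lerDl sumr_ge0// => j _.
by rewrite -expr2 sqr_ge0.
Qed.

Lemma continuous_dot (T : topologicalType) (f g : T -> 'rV[R]_n) :
  continuous f -> continuous g -> continuous (fun t => dot (f t) (g t)).
Proof.
move=> cf cg t; apply: cvg_big => [|i _]; first exact: add_continuous.
have c (h : T -> 'rV[R]_n) : continuous h -> (fun t => h t 0 i) @ t --> h t 0 i.
  move=> ch; apply: (@cvg_comp _ _ _ h (fun M : 'rV[R]_n => M 0 i) _ _ _ (ch t)).
  exact: coord_continuous.
by apply: cvgM; exact: c.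
Qed.

End Euclid.

(** * Limits of real numbers and rows *)

(** Turns an inequality along a segment, divided by the step t, into its first
    order consequence. *)
Lemma le0_of_le_small {R : realType} (a b : R) :
  (forall t, 0 < t < 1 -> a <= t * b) -> a <= 0.
Proof.
move=> h; rewrite leNgt; apply/negP => a0.
(* This step t satisfies t * b < a when a > 0. *)
have bb := ler_norm b; have b0 := normr_ge0 b.
set c := `|b| in bb b0; have d0 : 0 < a + a + c by lra.
have t01 : 0 < a / (a + a + c) < 1.
  by rewrite divr_gt0//= ltr_pdivrMr//; lra.
by have := h _ t01; rewrite mulrAC ler_pdivlMr//; nra.
Qed.

(** Each u i - C/(i+1) is below each u j + C/(j+1), so the supremum of the former
    separates the two families and is the limit. *)
Lemma cauchy_rate_limit {R : realType} (u : nat -> R) (C : R) :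
  (forall i j, `|u i - u j| <= C / i.+1%:R + C / j.+1%:R) ->
  exists l, forall i, `|u i - l| <= C / i.+1%:R.
Proof.
move=> hu; pose e i := C / i.+1%:R.
pose A := [set u i - e i | i in [set: nat]].
have ub j : ubound A (u j + e j).
  move=> _ [i _ <-]; have := hu i j; rewrite -/(e i) -/(e j) ler_norml.
  by move=> /andP[_]; lra.
have supA : has_sup A.
  by split; [exists (u 0 - e 0); exists 0%N|exists (u 0 + e 0); exact: ub].
exists (sup A) => i; rewrite -/(e i) ler_norml; apply/andP; split.
  by have := ge_sup supA.1 (ub i); lra.
have : A (u i - e i) by exists i.
by move=> /(sup_upper_bound supA); lra.
Qed.

Lemma cvg_row {R : realType} {n : nat} (u : nat -> 'rV[R]_n) (l : 'rV[R]_n)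
    (C : R) :
  (forall N i, `|u N 0 i - l 0 i| <= C / N.+1%:R) -> u @ \oo --> l.
Proof.
move=> ul; apply/cvg_ballP => e e0.
have h : (fun N => C * harmonic N) @ \oo --> C * 0.
  by apply: cvgM; [exact: cvg_cst|exact: cvg_harmonic].
rewrite mulr0 in h.
have /cvgrPdist_lt /(_ _ e0) := h; apply: filterS => N; rewrite sub0r normrN => hN.
split => // i j; rewrite /ball /= (ord1 i) distrC.
by apply: le_lt_trans (ul N j) _; apply: le_lt_trans hN; exact: ler_norm.
Qed.

(** * Existence of subgradients *)

Section Subgradients.
Context {R : realType} {n : nat}.
Implicit Types (f : 'rV[R]_n -> \bar R) (x y z a p g : 'rV[R]_n).

Lemma proper_finite f x : proper_fun f -> (f x < +oo)%E -> exists r, f x = r%:E.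
Proof.
move=> [fN _] fx; exists (fine (f x)); rewrite fineK//.
by rewrite fin_numElt fN fx.
Qed.

Lemma minimizer_finite f a :
  proper_fun f -> is_minimizer f a -> exists r, f a = r%:E.
Proof.
move=> pf am; apply: proper_finite => //; have [_ [x fx]] := pf.
exact: le_lt_trans (am x) fx.
Qed.

Lemma subdiff_minimizer f a : proper_fun f -> is_minimizer f a -> subdiff f a 0.
Proof.
move=> pf am; have [r fa] := minimizer_finite f a pf am.
by split=> [|y]; rewrite ?fa ?ltry// -fa dot0l adde0.
Qed.

Lemma subdiff_monotone f x1 x2 g1 g2 : proper_fun f ->
  subdiff f x1 g1 -> subdiff f x2 g2 -> 0 <= dot (g1 - g2) (x1 - x2).
Proof.
move=> pf [f1 h1] [f2 h2].
have [r1 e1] := proper_finite f x1 pf f1; have [r2 e2] := proper_finite f x2 pf f2.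
have := h1 x2; have := h2 x1; rewrite e1 e2 -!EFinD !lee_fin !dotE; lra.
Qed.

(** The proximal point of z with weight lam. Points outside the box of radius
    |a - z| around z, and heights above f a + lam/2 |a - z|^2, cannot improve on a,
    so the minimum is taken over a compact part of the epigraph; working in the
    epigraph makes the objective continuous although f is only closed. *)
Lemma prox_exists f a z (lam : R) : proper_fun f -> closed_fun f ->
  is_minimizer f a -> 0 <= lam ->
  exists p r, f p = r%:E /\ forall y s, (f y <= s%:E)%E ->
    r + lam / 2 * dot (p - z) (p - z) <= s + lam / 2 * dot (y - z) (y - z).
Proof.
move=> pf cf am lam0; have [ra fa] := minimizer_finite f a pf am.
pose rho := enorm (a - z); pose B := ra + lam / 2 * rho ^+ 2.
pose box := [set v : 'rV[R]_n |
  forall i, `[z 0 i - rho, z 0 i + rho]%classic (v ord0 i)].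
pose K := (box `*` `[ra, B]%classic) `&`
  [set q : 'rV[R]_n * R | (f q.1 <= q.2%:E)%E].
pose phi (q : 'rV[R]_n * R) := q.2 + lam / 2 * dot (q.1 - z) (q.1 - z).
have rho0 : 0 <= rho by exact: enorm_ge0.
have B_ge : ra <= B by rewrite lerDl mulr_ge0 ?divr_ge0 ?sqr_ge0.
have far (v : 'rV[R]_n) i : v 0 i \notin `[z 0 i - rho, z 0 i + rho] ->
    rho ^+ 2 <= dot (v - z) (v - z).
  move=> vi; rewrite -sqr_enorm ler_pXn2r ?nnegrE ?enorm_ge0//.
  apply: le_trans (coord_le_enorm _ i); rewrite !mxE leNgt ltr_norml.
  by apply: contra vi; rewrite in_itv/=; lra.
have aK : K (a, ra).
  split=> [|/=]; last by rewrite fa.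
  split=> /= [i|]; last by rewrite in_itv/= lexx.
  have := coord_le_enorm (a - z) i; rewrite -/rho !mxE ler_norml => h.
  by rewrite /= in_itv/=; lra.
have cK : compact K.
  apply: compact_closedI; last exact: cf.
  apply: compact_setX; last exact: segment_compact.
  apply: (@rV_compact _ _ (fun i => `[z 0 i - rho, z 0 i + rho]%classic)) => i.
  exact: segment_compact.
have cphi : continuous phi.
  have c1 : continuous (fun q : 'rV[R]_n * R => q.1 - z).
    by move=> q; apply: cvgB; [exact: cvg_fst|exact: cvg_cst].
  move=> q; apply: cvgD; first exact: cvg_snd.
  apply: cvgM; first exact: cvg_cst.
  exact: (continuous_dot _ _ _ c1 c1).
have [[p r] pK pmin] :=
  compact_EVT_min (ex_intro K _ aK) cK (continuous_subspaceT cphi).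
have {pK} [[_ /=]] : K (p, r) by rewrite inE in pK.
rewrite in_itv/= => /andP[rar rB] fpr.
have [r' fp] : exists r', f p = r'%:E.
  by apply: proper_finite => //; apply: le_lt_trans fpr _; exact: ltry.
exists p, r'; split=> // y s fys.
have r'r : r' <= r by rewrite fp lee_fin in fpr.
have ras : ra <= s by have := le_trans (am y) fys; rewrite fa lee_fin.
have aB : phi (p, r) <= B.
  by apply: le_trans (pmin (a, ra) _) _; rewrite ?inE// /phi/= -sqr_enorm.
have yz0 : 0 <= lam / 2 * dot (y - z) (y - z).
  by rewrite mulr_ge0 ?dotxx_ge0// divr_ge0.
suff : phi (p, r) <= phi (y, s) by rewrite /phi/=; lra.
have [sB|Bs] := leP s B; last first.
  by apply: le_trans aB _; rewrite /phi/=; lra.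
have [yb|] := pselect (box y).
  by apply: pmin; rewrite inE; split=> //=; split=> //=; rewrite in_itv/= ras.
move=> /existsNP[i /negP yi].
apply: le_trans aB _; rewrite /phi /B/= lerD// ler_wpM2l ?divr_ge0//.
exact: far yi.
Qed.

(** First order optimality of the proximal point, along segments. *)
Lemma prox_subdiff f a z (lam : R) : proper_fun f -> closed_fun f ->
  convex_fun f -> is_minimizer f a -> 0 <= lam ->
  exists p, subdiff f p (lam *: (z - p)).
Proof.
move=> pf cf vf am lam0; have [p [r [fp pmin]]] := prox_exists f a z lam pf cf am lam0.
exists p; split=> [|y]; first by rewrite fp ltry.
have [fy|] := ltP (f y) +oo%E; last by rewrite leye_eq => /eqP ->; exact: leey.
have [s fs] := proper_finite f y pf fy.
rewrite fp fs -EFinD lee_fin -subr_le0.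
apply: (@le0_of_le_small _ _ (lam / 2 * dot (y - p) (y - p))) => t /andP[t0 t1].
have tI : 0 <= t <= 1 by rewrite !ltW.
have := vf y p t tI; rewrite fp fs -!EFinM -EFinD => /pmin.
have -> : t *: y + (1 - t) *: p - z = (p - z) + t *: (y - p).
  by apply/rowP => i; rewrite !mxE; ring.
rewrite -[z - p]opprB; move: (y - p) (p - z) => d w.
by rewrite !dotE (dotC d w) => h; rewrite -(ler_pM2l t0); lra.
Qed.

(** Let p_N be the proximal point of x with weight N+1 and
    g_N = (N+1)(x - p_N) its subgradient. Monotonicity against 0, a subgradient at a,
    gives |p_N - a| <= |x - a|, hence |g_N| <= L |x - a| and p_N -> x at rate 1/(N+1).
    The Lipschitz condition carries this rate over to the g_N, whose limit is a
    subgradient at x because the epigraph is closed. In particular f x is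
    finite. *)
Lemma smooth_subdiff f a (L : R) : proper_fun f -> closed_fun f ->
  convex_fun f -> is_minimizer f a -> 0 <= L ->
  (forall x1 x2 g1 g2, subdiff f x1 g1 -> subdiff f x2 g2 ->
    enorm (g1 - g2) <= L * enorm (x1 - x2)) ->
  forall x, exists g, subdiff f x g.
Proof.
move=> pf cf vf am L0 Lf x; have sa := subdiff_minimizer f a pf am.
have /choice[p sp] : forall N : nat, exists p, subdiff f p (N.+1%:R *: (x - p)).
  by move=> N; apply: (prox_subdiff f a).
pose g N := N.+1%:R *: (x - p N); pose C := L * enorm (x - a).
have pa N : enorm (p N - a) <= enorm (x - a).
  have := subdiff_monotone f _ _ _ _ pf (sp N) sa.
  rewrite subr0 dotZl pmulr_rge0 ?ltr0Sn//.
  have -> : x - p N = (x - a) - (p N - a) by rewrite opprB addrA subrK.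
  rewrite dotDl dotNl -sqr_enorm => h.
  have := cauchy_schwarz (x - a) (p N - a).
  have := enorm_ge0 (p N - a); have := enorm_ge0 (x - a); nra.
have px N : enorm (p N - x) <= C / N.+1%:R.
  rewrite ler_pdivlMr ?ltr0Sn// mulrC enormB.
  have := Lf _ _ _ _ (sp N) sa; rewrite subr0 enormZ ger0_norm// => /le_trans.
  by apply; rewrite ler_wpM2l.
have gg i j : enorm (g i - g j) <= L * C / i.+1%:R + L * C / j.+1%:R.
  apply: le_trans (Lf _ _ _ _ (sp i) (sp j)) _.
  rewrite -[L * C / _]mulrA -[L * C / j.+1%:R]mulrA -mulrDr ler_wpM2l//.
  have -> : p i - p j = (p i - x) + (x - p j) by rewrite addrA subrK.
  apply: le_trans (enormD _ _) _; apply: lerD; first exact: px.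
  by rewrite enormB; exact: px.
have /choice[l gl] : forall k : 'I_n, exists l,
    forall N, `|g N 0 k - l| <= L * C / N.+1%:R.
  move=> k; apply: cauchy_rate_limit => i j.
  by apply: le_trans (gg i j); have := coord_le_enorm (g i - g j) k; rewrite !mxE.
pose gx : 'rV[R]_n := \row_k l k.
have cg : g @ \oo --> gx.
  apply: (@cvg_row _ _ _ _ (L * C)) => N i.
  have -> : gx 0 i = l i by rewrite mxE.
  exact: gl.
have cp : p @ \oo --> x.
  apply: (@cvg_row _ _ _ _ C) => N i; apply: le_trans (px N).
  by have := coord_le_enorm (p N - x) i; rewrite !mxE.
have main y s : f y = s%:E -> (f x <= (s - dot gx (y - x))%:E)%E.
  move=> fy; pose u N := (p N, s - dot (g N) (y - p N)).
  apply: (closed_cvg (u_ := u) (F := \oo) _ cf _ (x, s - dot gx (y - x))).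
    apply: nearW => N /=; have [fpN /(_ y)] := sp N.
    have [r ->] := proper_finite f (p N) pf fpN.
    by rewrite fy -EFinD !lee_fin lerBrDr.
  have cd : continuous (fun q : 'rV[R]_n * 'rV[R]_n => dot q.1 q.2).
    by apply: continuous_dot => q; [exact: cvg_fst|exact: cvg_snd].
  have cy : (fun N => y - p N) @ \oo --> y - x.
    by apply: cvgB => //; exact: cvg_cst.
  have cs : (fun N => s - dot (g N) (y - p N)) @ \oo --> s - dot gx (y - x).
    apply: cvgB; first exact: cvg_cst.
    exact: (cvg_comp _ _ (cvg_pair cg cy) (cd (gx, y - x))).
  exact: (cvg_pair cp cs).
have [ra fa] := minimizer_finite f a pf am.
have fx : (f x < +oo)%E by apply: le_lt_trans (main _ _ fa) _; exact: ltry.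
exists gx; split=> // y.
have [fy|] := ltP (f y) +oo%E; last by rewrite leye_eq => /eqP ->; exact: leey.
have [s fs] := proper_finite f y pf fy; have [r fr] := proper_finite f x pf fx.
by have := main y s fs; rewrite fr fs -EFinD !lee_fin lerBrDr.
Qed.

End Subgradients.

(** * Gradients of smooth and strongly convex functions *)

Section SmoothStrong.
Context {R : realType} {n : nat}.
Implicit Types (f : 'rV[R]_n -> \bar R) (x y z a p g : 'rV[R]_n) (mu L : R).

(** With constant L in place of L/2 the bound follows from the subgradient
    inequality at y. Applying a bound with constant c to both halves of the segment
    [x, y], and the Lipschitz condition at the midpoint, gives the constant
    c/2 + L/4; the iterates of this map decrease to L/2. *)
Lemma descent (F : 'rV[R]_n -> R) (G : 'rV[R]_n -> 'rV[R]_n) L : 0 <= L ->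
  (forall x y, F x + dot (G x) (y - x) <= F y) ->
  (forall x y, enorm (G x - G y) <= L * enorm (x - y)) ->
  forall x y, F y <= F x + dot (G x) (y - x) + L / 2 * dot (y - x) (y - x).
Proof.
move=> L0 sub lip.
have lip_dot x y z : dot (G y - G x) z <= L * enorm (y - x) * enorm z.
  by apply: le_trans (cauchy_schwarz _ _) _; rewrite ler_wpM2r ?enorm_ge0.
(* The error L/2/(k+1) is weaker than the geometric one, and simpler to use. *)
have approx k : forall x y, F y <= F x + dot (G x) (y - x) +
    (L / 2 + L / 2 / k.+1%:R) * dot (y - x) (y - x).
  elim: k => [|k IHk] x y.
    have := sub y x; have := lip_dot x y (y - x).
    rewrite -[x - y]opprB -mulrA -expr2 sqr_enorm divr1; move: (y - x) => d.
    rewrite !dotE; lra.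
  pose m := x + 2^-1 *: (y - x).
  have mx : m - x = 2^-1 *: (y - x) by rewrite /m addrC addKr.
  have ym : y - m = 2^-1 *: (y - x).
    by apply/rowP => i; rewrite !mxE; field.
  have := IHk x m; have := IHk m y; have := lip_dot x m (y - x).
  rewrite ym mx enormZ ger0_norm ?invr_ge0// -[L * _ * _]mulrA.
  rewrite -[2^-1 * _ * _]mulrA -expr2 sqr_enorm.
  have := dotxx_ge0 (y - x); move: (y - x) => d d0.
  rewrite !dotE => h1 h2 h3.
  have : L / 2 / k.+1%:R / 2 * dot d d <= L / 2 / k.+2%:R * dot d d.
    rewrite ler_wpM2r// -[_ / _ / 2]mulrA ler_wpM2l ?divr_ge0// -invfM.
    rewrite lef_pV2 ?posrE ?mulr_gt0 ?ltr0n// -natrM ler_nat muln2 doubleS.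
    by rewrite !ltnS -addnn leq_addr.
  by move: h1 h2 h3; move: (_ / k.+1%:R) (_ / k.+2%:R) => e1 e2; lra.
move=> x y; rewrite -subr_le0.
apply: (@le0_of_le_small _ _ (L / 2 * dot (y - x) (y - x))) => t /andP[t0 _].
pose k := Num.bound t^-1.
have kt : k.+1%:R^-1 <= t.
  rewrite invf_ple ?posrE ?ltr0Sn//; apply: ltW.
  apply: lt_le_trans (archi_boundP _) _; first by rewrite invr_ge0 ltW.
  by rewrite ler_nat leqnSn.
have := approx k x y; have d0 := dotxx_ge0 (y - x).
have : L / 2 / k.+1%:R * dot (y - x) (y - x) <= t * (L / 2 * dot (y - x) (y - x)).
  by rewrite mulrA ler_wpM2r// mulrC ler_wpM2r// divr_ge0.
by move: (L / 2 / k.+1%:R) => c; lra.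
Qed.

(** Cocoercivity of the gradient of F - mu/2 |.|^2, which is (L - mu)-smooth and
    convex; the bounds are kept in terms of F itself. *)
Lemma cocoercive (F : 'rV[R]_n -> R) (G : 'rV[R]_n -> 'rV[R]_n) mu L : mu < L ->
  (forall x y,
    F x + dot (G x) (y - x) + mu / 2 * dot (y - x) (y - x) <= F y) ->
  (forall x y,
    F y <= F x + dot (G x) (y - x) + L / 2 * dot (y - x) (y - x)) ->
  forall x y, let w := G x - G y - mu *: (x - y) in
  dot w w <= (L - mu) * dot w (x - y).
Proof.
move=> muL lo up x y /=; set w := _ - _ - _.
have l0 : 0 < L - mu by rewrite subr_gt0.
(* z minimizes the difference between the upper bound at u and the lower bound
   at v; comparing the two there gives one half of the estimate. *)
have half u v : let w := G u - G v - mu *: (u - v) in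
    F v + dot (G v) (u - v) + mu / 2 * dot (u - v) (u - v)
      + (L - mu)^-1 / 2 * dot w w <= F u.
  rewrite /=; set b := _ - _ - _; set s := (L - mu)^-1; pose z := u - s *: b.
  have := le_trans (lo v z) (up u z).
  have -> : z - u = - (s *: b) by rewrite /z addrAC subrr add0r.
  have -> : z - v = (u - v) - s *: b by rewrite /z addrAC.
  have sl : s * (s * (L - mu)) = s by rewrite /s mulVf ?mulr1// gt_eqF.
  have bE : dot b b = dot (G u) b - dot (G v) b - mu * dot (u - v) b.
    by rewrite {1}/b !dotDl !dotNl dotZl dotDl dotNl.
  move: bE sl; move: (u - v) (b) (s) => e {z}b {}s bE sl; rewrite !dotE (dotC b e) => h.
  have : s * (s * (L - mu)) * dot b b = s * dot b b by rewrite sl.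
  have : s * dot b b = s * (dot (G u) b - dot (G v) b - mu * dot e b).
    by rewrite bE.
  lra.
have := half x y; have /= := half y x.
have -> : G y - G x - mu *: (y - x) = - w.
  by apply/rowP => i; rewrite /w !mxE; ring.
rewrite -/w -[y - x]opprB.
have wE : dot w (x - y) = dot (G x) (x - y) - dot (G y) (x - y)
    - mu * dot (x - y) (x - y) by rewrite {1}/w !dotDl !dotNl dotZl dotDl dotNl.
move: wE; move: (x - y) (w) => e b bE; rewrite !dotE => h1 h2.
rewrite -ler_pdivrMl// bE; lra.
Qed.

Lemma strongly_convex_segment f mu x y r s (t : R) : 0 <= t <= 1 ->
  strongly_convex mu f -> f x = r%:E -> f y = s%:E ->
  (f (t *: x + (1 - t) *: y)%R <=
    (t * r + (1 - t) * s - mu / 2 * (t * (1 - t)) * dot (x - y) (x - y))%:E)%E.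
Proof.
move=> t01 sc fx fy; have := sc x y t t01.
rewrite fx fy -!EFinB -!EFinM -EFinD leeBlDr// -EFinD => /le_trans; apply.
by rewrite lee_fin !sqr_enorm !dotE (dotC y x); lra.
Qed.

Lemma strongly_convex_subdiff f mu x y g r s :
  strongly_convex mu f -> subdiff f x g -> f x = r%:E -> f y = s%:E ->
  r + dot g (y - x) + mu / 2 * dot (y - x) (y - x) <= s.
Proof.
move=> sc [_ sg] fx fy; rewrite -subr_le0.
apply: (@le0_of_le_small _ _ (mu / 2 * dot (y - x) (y - x))) => t /andP[t0 t1].
have tI : 0 <= t <= 1 by rewrite !ltW.
have := le_trans (sg _) (strongly_convex_segment _ _ _ _ _ _ _ tI sc fy fx).
rewrite fx -EFinD lee_fin.
have -> : t *: y + (1 - t) *: x - x = t *: (y - x).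
  by apply/rowP => i; rewrite !mxE; ring.
by rewrite dotZr => h; rewrite -(ler_pM2l t0); lra.
Qed.

(** The last clause expresses that the gradient lies in the ball of center
    (L + mu)/2 (x - a) and radius (L - mu)/2 |x - a|. *)
Lemma classM_gradient f mu L a x : 0 <= mu -> mu < L -> classM mu L%:E a f ->
  exists rg : R * 'rV[R]_n,
  [/\ f x = rg.1%:E,
      forall y, (f y <= (rg.1 + dot rg.2 (y - x)
                         + L / 2 * dot (y - x) (y - x))%:E)%E
    & forall e, (L + mu) / 2 * dot (x - a) e
                - (L - mu) / 2 * (enorm (x - a) * enorm e) <= dot rg.2 e].
Proof.
move=> mu0 muL [[pf cf vf sf sc] am].
have L0 : 0 <= L by apply: le_trans mu0 (ltW muL).
have lip x1 x2 g1 g2 : subdiff f x1 g1 -> subdiff f x2 g2 ->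
    enorm (g1 - g2) <= L * enorm (x1 - x2).
  by apply: sf; exact: ltry.
have /choice[G sG] := smooth_subdiff f a L pf cf vf am L0 lip.
pose F y := fine (f y).
have FE y : f y = (F y)%:E.
  have [fy _] := sG y; have [r fr] := proper_finite f y pf fy.
  by rewrite /F fr.
have lo u v : F u + dot (G u) (v - u) + mu / 2 * dot (v - u) (v - u) <= F v.
  exact: (strongly_convex_subdiff _ _ _ _ _ _ _ sc (sG u) (FE u) (FE v)).
have up : forall u v, F v <= F u + dot (G u) (v - u) + L / 2 * dot (v - u) (v - u).
  apply: descent => // u v; last exact: lip.
  by have [_ /(_ v)] := sG u; rewrite !FE -EFinD lee_fin.
have Ga : G a = 0.
  have := lip _ _ _ _ (sG a) (subdiff_minimizer f a pf am).
  rewrite !subrr -[X in L * enorm X](scale0r 0) enormZ normr0 mul0r mulr0 subr0.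
  by move=> h; apply: enorm_eq0; apply: le_anti; rewrite h enorm_ge0.
exists (F x, G x); split=> //= [y|e]; first by rewrite FE lee_fin.
have := cocoercive F G mu L muL lo up x a; rewrite Ga subr0 /=.
set w := G x - _; set d := x - a => wd.
(* Completing the square in |w|^2 <= (L - mu) <w, d>. *)
have ball : enorm (w - ((L - mu) / 2) *: d) <= (L - mu) / 2 * enorm d.
  rewrite ler_enorm_sqr; last first.
    by rewrite mulr_ge0 ?enorm_ge0// divr_ge0// subr_ge0 ltW.
  rewrite exprMn sqr_enorm; move: wd; move: (w) (d) => u c; rewrite !dotE (dotC c u); lra.
have := cauchy_schwarz (- (w - ((L - mu) / 2) *: d)) e; rewrite enormN => h.
have : enorm (w - ((L - mu) / 2) *: d) * enorm e
    <= (L - mu) / 2 * enorm d * enorm e by rewrite ler_wpM2r ?enorm_ge0.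
by move: h; rewrite {1}/w !dotE; lra.
Qed.

End SmoothStrong.

(** * Necessity of the inequality *)

Lemma minimizer_sum_necessary (R : realType) (n k : nat)
  (mu : 'I_k.+1 -> R) (L : 'I_k.+1 -> \bar R)
  (hmuL : forall i : 'I_k.+1, i != ord_max ->
     [/\ 0 <= mu i, ((mu i)%:E < L i)%E & (L i < +oo)%E])
  (xs : 'I_k.+1 -> 'rV[R]_n) (x : 'rV[R]_n) (f : 'I_k.+1 -> 'rV[R]_n -> \bar R) :
  (forall i : 'I_k.+1, classM (mu i) (L i) (xs i) (f i)) ->
  is_minimizer (fun y : 'rV[R]_n => (\sum_(i < k.+1) f i y)%E) x ->
  \sum_(i < k.+1 | i != ord_max)
      (fine (L i) + mu i) / 2 * dot (x - xs i) (x - xs ord_max)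
    + mu ord_max * enorm (x - xs ord_max) ^+ 2
  <= \sum_(i < k.+1 | i != ord_max)
      (fine (L i) - mu i) / 2 * (enorm (x - xs i) * enorm (x - xs ord_max)).
Proof.
move=> fM xmin; pose l i := fine (L i); pose m : 'I_k.+1 := ord_max.
have [[pm _ _ _ scm] mm] := fM m.
have /choice[rg rgP] : forall i, exists rg : R * 'rV[R]_n, i != m ->
  [/\ f i x = rg.1%:E,
      forall y, (f i y <= (rg.1 + dot rg.2 (y - x)
                         + l i / 2 * dot (y - x) (y - x))%:E)%E
    & forall e, (l i + mu i) / 2 * dot (x - xs i) e
                - (l i - mu i) / 2 * (enorm (x - xs i) * enorm e) <= dot rg.2 e].
  move=> i; have [->|im] := eqVneq i m; first by exists (0, 0).
  have [mu0 muL Loo] := hmuL i im.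
  have LE : L i = (l i)%:E.
    by rewrite /l fineK// fin_numElt Loo andbT (lt_trans _ muL)// ltNyr.
  have mul : mu i < l i by rewrite -lte_fin -LE.
  have fMi : classM (mu i) (l i)%:E (xs i) (f i) by rewrite -LE.
  by have [rg] := classM_gradient _ _ _ _ x mu0 mul fMi; exists rg.
pose e := x - xs m.
have [sm fsm] := minimizer_finite (f m) (xs m) pm mm.
have upper y s : (f m y <= s%:E)%E ->
    (\sum_(i < k.+1) f i y <=
      (s + \sum_(i < k.+1 | i != m) ((rg i).1 + dot (rg i).2 (y - x)
        + l i / 2 * dot (y - x) (y - x)))%:E)%E.
  move=> fy; rewrite (bigD1 m)//= EFinD -sumEFin; apply: leeD => //.
  by apply: lee_sum => i im; have [_ + _] := rgP i im; exact.
have sumx : (\sum_(i < k.+1) f i x = f m x + (\sum_(i < k.+1 | i != m) (rg i).1)%:E)%E.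
  rewrite (bigD1 m)//= -sumEFin; congr (_ + _)%E.
  by apply: eq_bigr => i im; have [] := rgP i im.
(* The value at x is at most the value at xs m, where all summands are finite. *)
have [rm frm] : exists rm, f m x = rm%:E.
  apply: proper_finite => //.
  have := le_trans (xmin (xs m)) (upper _ sm _); rewrite fsm lexx sumx => /(_ isT).
  by case: (f m x) => [r _||]//; rewrite ltry.
have gap : sm + mu m / 2 * dot e e <= rm.
  have := strongly_convex_subdiff _ _ _ _ _ _ _ scm
    (subdiff_minimizer _ _ pm mm) fsm frm.
  by rewrite dot0l addr0.
pose S := \sum_(i < k.+1 | i != m) dot (rg i).2 e.
suff Sle : S + mu m * dot e e <= 0.
  rewrite -/m -/e sqr_enorm -lerBrDr -subr_ge0 addrAC -sumrB.
  apply: le_trans (_ : - (S + mu m * dot e e) <= _); first by rewrite oppr_ge0.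
  rewrite opprD lerD2r -sumrN; apply: ler_sum => i im.
  by have [_ _ /(_ e)] := rgP i im; rewrite /l -/e; lra.
pose Q := \sum_(i < k.+1 | i != m) l i / 2 * dot e e.
apply: (@le0_of_le_small _ _ (Q + mu m / 2 * dot e e)) => t /andP[t0 t1].
have tI : 0 <= t <= 1 by rewrite !ltW.
(* Compare x with a point of the segment from x to xs m. *)
pose y := t *: xs m + (1 - t) *: x.
have yx : y - x = - t *: e by apply/rowP => i; rewrite /y /e !mxE; ring.
have := le_trans (xmin y)
  (upper _ _ (strongly_convex_segment _ _ _ _ _ _ _ tI scm fsm frm)).
rewrite sumx frm -EFinD lee_fin yx !big_split/=.
under [X in _ + (_ + X + _)]eq_bigr do rewrite dotZr.
under [X in _ + (_ + _ + X)]eq_bigr do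
  rewrite dotZl dotZr mulrCA [l _ / 2 * _]mulrCA.
rewrite -!mulr_sumr -/S -/Q -[xs m - x]opprB -/e dotNl dotNr opprK => h.
rewrite -(ler_pM2l t0).
have : t * (sm + mu m / 2 * dot e e) <= t * rm by rewrite ler_pM2l.
lra.
Qed.

(** * Functions with prescribed gradient *)

Lemma continuous_subr {R : realType} {V : normedModType R} (a : V) :
  continuous (fun y : V => y - a).
Proof. by move=> y; apply: cvgB; [exact: cvg_id|exact: cvg_cst]. Qed.

Section Constructions.
Context {R : realType} {n : nat}.
Implicit Types (F : 'rV[R]_n -> R) (x y z a d e g h v : 'rV[R]_n) (mu l : R).

(** As mu >= 0, the quadratic inequality gives both convexity conditions. *)
Lemma classF_EFin F mu (L : \bar R) : 0 <= mu -> continuous F ->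
  (forall x y t, 0 <= t <= 1 -> F (t *: x + (1 - t) *: y) <=
    t * F x + (1 - t) * F y - mu / 2 * (t * (1 - t)) * dot (x - y) (x - y)) ->
  smooth L (EFin \o F) -> classF mu L (EFin \o F).
Proof.
move=> mu0 cF sc sm; split=> //.
- by split=> [x|]; [exact: ltNyr|exists 0; exact: ltry].
- rewrite /closed_fun.
  have -> : [set p : 'rV[R]_n * R | ((EFin \o F) p.1 <= p.2%:E)%E] =
      (fun p => F p.1 - p.2) @^-1` [set r | r <= 0].
    by apply/seteqP; split=> p /=; rewrite lee_fin subr_le0.
  apply: preimage_closed; last exact: closed_le.
  move=> p _; apply: cvgB; last exact: cvg_snd.
  by apply: (@cvg_comp _ _ _ fst F) (cF _); exact: cvg_fst.
- move=> x y t t01 /=; rewrite -!EFinM -EFinD lee_fin.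
  apply: le_trans (sc x y t t01) _; rewrite gerBl mulr_ge0 ?dotxx_ge0//.
  by move: t01 => /andP[t0 t1]; rewrite mulr_ge0 ?divr_ge0// mulr_ge0// subr_ge0.
- move=> x y t t01 /=; rewrite -!EFinB -!EFinM -EFinD lee_fin !sqr_enorm.
  by have := sc x y t t01; rewrite !dotE (dotC y x); lra.
Qed.

(** Take the test point x + t (g' - g) and let t tend to 0. *)
Lemma subdiff_eq_gradient F l x g g' : 0 <= l ->
  (forall y, F y <= F x + dot g (y - x) + l / 2 * dot (y - x) (y - x)) ->
  subdiff (EFin \o F) x g' -> g' = g.
Proof.
move=> l0 up [_ sg]; apply/eqP; rewrite -subr_eq0; apply/eqP; apply: dotxx_eq0.
apply: le_anti; rewrite dotxx_ge0 andbT.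
apply: (@le0_of_le_small _ _ (l / 2 * dot (g' - g) (g' - g))) => t /andP[t0 _].
have /= := sg (x + t *: (g' - g)); have := up (x + t *: (g' - g)).
rewrite -EFinD lee_fin [x + _ - x]addrAC subrr add0r => h1 h2.
have {h1 h2} := le_trans h2 h1.
have -> : dot (g' - g) (g' - g) = dot g' (g' - g) - dot g (g' - g).
  by rewrite dotDl dotNl.
rewrite !dotZl !dotZr dotDl dotNl => h.
by rewrite -(ler_pM2l t0); lra.
Qed.

(** Its Hessian mu I + (l - mu) v v^T has eigenvalues in [mu, l] when |v| <= 1. *)
Definition quad mu l a v y : R :=
  mu / 2 * dot (y - a) (y - a) + (l - mu) / 2 * dot v (y - a) ^+ 2.

Definition quad_grad mu l a v x : 'rV[R]_n :=
  mu *: (x - a) + ((l - mu) * dot v (x - a)) *: v.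

Lemma quad_expand mu l a v x y :
  quad mu l a v y = quad mu l a v x + dot (quad_grad mu l a v x) (y - x)
    + mu / 2 * dot (y - x) (y - x) + (l - mu) / 2 * dot v (y - x) ^+ 2.
Proof.
rewrite /quad /quad_grad.
have -> : y - a = (x - a) + (y - x) by rewrite [RHS]addrC addrA subrK.
move: (x - a) (y - x) => b c; rewrite !dotE (dotC c b); by field.
Qed.

Lemma quad_subgrad mu l a v x y : 0 <= mu -> mu < l ->
  quad mu l a v x + dot (quad_grad mu l a v x) (y - x) <= quad mu l a v y.
Proof.
move=> mu0 mul; rewrite (quad_expand mu l a v x y) -[leRHS]addrA lerDl addr_ge0//.
  by rewrite mulr_ge0 ?dotxx_ge0// divr_ge0.
by rewrite mulr_ge0 ?sqr_ge0// divr_ge0// subr_ge0 ltW.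
Qed.

Lemma sqr_dot_unit v z : enorm v <= 1 -> dot v z ^+ 2 <= dot z z.
Proof.
move=> v1; rewrite -sqr_enorm -[X in X <= _]real_normK ?num_real//.
rewrite ler_pXn2r ?nnegrE ?enorm_ge0// ler_norml.
have ez := enorm_ge0 z.
have := cauchy_schwarz v z; have := cauchy_schwarz (- v) z.
by rewrite enormN dotNl; nra.
Qed.

Lemma quad_classM mu l a v : 0 <= mu -> mu < l -> enorm v <= 1 ->
  classM mu l%:E a (EFin \o quad mu l a v).
Proof.
move=> mu0 mul v1; have l0 : 0 <= l - mu by rewrite subr_ge0 ltW.
have l0' : 0 <= l by apply: le_trans mu0 (ltW mul).
have cya := continuous_subr a.
split; last first.
  move=> y /=; rewrite lee_fin /quad subrr !dot0r expr0n/= !mulr0 addr0.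
  by rewrite addr_ge0// mulr_ge0 ?divr_ge0 ?sqr_ge0 ?dotxx_ge0.
apply: classF_EFin => //.
- have cv : continuous (fun y => dot v (y - a)).
    exact: continuous_dot (@cst_continuous _ _ v) cya.
  have cd : continuous (fun y => dot (y - a) (y - a)).
    exact: (continuous_dot _ _ _ cya cya).
  move=> y; exact: (cvgD (cvgM (cvg_cst _) (cd y))
    (cvgM (cvg_cst _) (cvgM (cv y) (cv y)))).
- move=> x y t /andP[t0 t1]; rewrite /quad.
  have -> : t *: x + (1 - t) *: y - a = t *: (x - a) + (1 - t) *: (y - a).
    by apply/rowP => i; rewrite !mxE; ring.
  have -> : x - y = (x - a) - (y - a) by rewrite opprB addrA subrK.
  move: (x - a) (y - a) => b c; rewrite !dotE (dotC c b).
  have : 0 <= (l - mu) / 2 * (t * (1 - t) * (dot v b - dot v c) ^+ 2).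
    by rewrite mulr_ge0 ?divr_ge0// mulr_ge0 ?sqr_ge0// mulr_ge0// subr_ge0.
  lra.
move=> _ x1 x2 g1 g2 s1 s2 /=.
have gradE x g : subdiff (EFin \o quad mu l a v) x g -> g = quad_grad mu l a v x.
  apply: (@subdiff_eq_gradient _ l) => // y.
  rewrite (quad_expand mu l a v x y) -[leLHS]addrA lerD2l.
  have := sqr_dot_unit v (y - x) v1 => h.
  have : (l - mu) / 2 * dot v (y - x) ^+ 2 <= (l - mu) / 2 * dot (y - x) (y - x).
    by rewrite ler_wpM2l// divr_ge0.
  lra.
rewrite (gradE _ _ s1) (gradE _ _ s2) /quad_grad.
have -> : mu *: (x1 - a) + ((l - mu) * dot v (x1 - a)) *: v -
    (mu *: (x2 - a) + ((l - mu) * dot v (x2 - a)) *: v) =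
    mu *: (x1 - x2) + ((l - mu) * dot v (x1 - x2)) *: v.
  rewrite !dotE; apply/rowP => i; rewrite !mxE; ring.
apply: le_trans (enormD _ _) _; rewrite !enormZ normrM (ger0_norm mu0) (ger0_norm l0).
have : `|dot v (x1 - x2)| * enorm v <= enorm (x1 - x2).
  apply: le_trans (_ : `|dot v (x1 - x2)| <= _); first by rewrite ler_piMr.
  rewrite -(@ler_pXn2r _ 2) ?nnegrE ?enorm_ge0// real_normK ?num_real//.
  by rewrite sqr_enorm; exact: sqr_dot_unit.
move: (enorm (x1 - x2)) => N h.
have : (l - mu) * (`|dot v (x1 - x2)| * enorm v) <= (l - mu) * N.
  by rewrite ler_wpM2l.
lra.
Qed.

(** With this v the gradient of the quadratic at displacement d from its center attains
    the lower bound on <g, e>. It is the unit vector along |e| d - |d| e, the normal of the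
    reflection that exchanges the directions of d and e, or 0 if d and e have the
    same direction or one of them vanishes. *)
Lemma extremal_direction d e : exists v, enorm v <= 1 /\
  dot v d * dot v e = (dot d e - enorm d * enorm e) / 2.
Proof.
pose w := enorm e *: d - enorm d *: e.
have wd : dot w d = enorm d * (enorm d * enorm e - dot d e).
  by rewrite !dotE (dotC e d) -sqr_enorm; ring.
have we : dot w e = enorm e * (dot d e - enorm d * enorm e).
  by rewrite !dotE -sqr_enorm; ring.
have ww : dot w w = 2 * (enorm d * enorm e) * (enorm d * enorm e - dot d e).
  by rewrite {2}/w !dotDr !dotNr !dotZr wd we; ring.
have [w0|w0] := eqVneq w 0.
  exists 0; rewrite !dot0l mulr0; split.
    by rewrite ler_enorm_sqr ?ler01// dot0l expr1n ler01.
  suff : dot d e = enorm d * enorm e by move=> ->; rewrite subrr mul0r.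
  move: ww; rewrite w0 dot0l => /esym/eqP; rewrite !mulf_eq0 pnatr_eq0/=.
  case/orP => [/orP[/eqP d0|/eqP e0]|]; last by rewrite subr_eq0 => /eqP.
  - by rewrite d0 (enorm_eq0 _ d0) dot0l mul0r.
  - by rewrite e0 (enorm_eq0 _ e0) dot0r mulr0.
have N0 : enorm w != 0 by apply: contra w0 => /eqP /enorm_eq0 ->.
exists ((enorm w)^-1 *: w); split.
  by rewrite enormZ ger0_norm ?invr_ge0 ?enorm_ge0// mulVf.
rewrite !dotZl mulrACA -invfM -expr2 sqr_enorm wd we.
have : dot w w != 0 by rewrite -sqr_enorm expf_neq0.
rewrite ww; set p := enorm d; set q := enorm e; set c := dot d e => h.
have [hp hq hc] : [/\ p != 0, q != 0 & p * q - c != 0].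
  by move: h; rewrite !mulf_eq0 !negb_or => /andP[/andP[_ /andP[]]].
by field; rewrite hp hq hc.
Qed.

(** The function used for the nonsmooth summand: at x it has the subgradient
    mu (x - a) + h. *)
Definition ramp mu a x h y : R :=
  mu / 2 * dot (y - a) (y - a) + Num.max 0 (dot h (y - x)).

Lemma ramp_classM mu a x h : 0 <= mu -> 0 <= dot h (x - a) ->
  classM mu +oo%E a (EFin \o ramp mu a x h).
Proof.
move=> mu0 ha; split; last first.
  move=> y /=; rewrite lee_fin /ramp subrr dot0r mulr0 add0r.
  rewrite max_l; last by rewrite -opprB dotNr oppr_le0.
  by rewrite addr_ge0 ?le_max ?lexx// mulr_ge0 ?divr_ge0 ?dotxx_ge0.
apply: classF_EFin => //.
- have cB (b : 'rV[R]_n) := continuous_subr b.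
  have cd : continuous (fun y => dot (y - a) (y - a)).
    exact: (continuous_dot _ _ _ (cB a) (cB a)).
  have ch : continuous (fun y => dot h (y - x)).
    exact: continuous_dot (@cst_continuous _ _ h) (cB x).
  have cm : continuous (fun y => Num.max 0 (dot h (y - x))).
    by move=> y; exact: (continuous_max (@cst_continuous _ _ (0 : R) y) (ch y)).
  by move=> y; exact: (cvgD (cvgM (cvg_cst _) (cd y)) (cm y)).
- move=> y z t /andP[t0 t1]; rewrite /ramp.
  have -> : t *: y + (1 - t) *: z - x = t *: (y - x) + (1 - t) *: (z - x).
    by apply/rowP => i; rewrite !mxE; ring.
  have -> : t *: y + (1 - t) *: z - a = t *: (y - a) + (1 - t) *: (z - a).
    by apply/rowP => i; rewrite !mxE; ring.
  have -> : y - z = (y - a) - (z - a) by rewrite opprB addrA subrK.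
  have : Num.max 0 (dot h (t *: (y - x) + (1 - t) *: (z - x))) <=
      t * Num.max 0 (dot h (y - x)) + (1 - t) * Num.max 0 (dot h (z - x)).
    have t1' : 0 <= 1 - t by rewrite subr_ge0.
    rewrite ge_max addr_ge0 ?mulr_ge0 ?le_max ?lexx//= !dotE.
    by rewrite lerD// ler_wpM2l// le_max lexx orbT.
  move: (y - a) (z - a) => b c; rewrite [dot (_ + _) _]dotDl !dotE (dotC c b).
  lra.
Qed.

Lemma ramp_subgrad mu a x h y : 0 <= mu ->
  ramp mu a x h x + dot (mu *: (x - a) + h) (y - x)
    <= ramp mu a x h y.
Proof.
move=> mu0; rewrite /ramp subrr dot0r maxxx addr0.
have : dot h (y - x) <= Num.max 0 (dot h (y - x)) by rewrite le_max lexx orbT.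
have : 0 <= mu / 2 * dot (y - x) (y - x).
  by rewrite mulr_ge0 ?divr_ge0 ?dotxx_ge0.
have -> : y - a = (x - a) + (y - x) by rewrite [RHS]addrC addrA subrK.
by move: (x - a) (y - x) => b c; rewrite !dotE (dotC c b); lra.
Qed.

End Constructions.

(** * Sufficiency of the inequality *)

Lemma minimizer_sum_sufficient (R : realType) (n k : nat)
  (mu : 'I_k.+1 -> R) (L : 'I_k.+1 -> \bar R)
  (hmuL : forall i : 'I_k.+1, i != ord_max ->
     [/\ 0 <= mu i, ((mu i)%:E < L i)%E & (L i < +oo)%E])
  (hmum : 0 <= mu ord_max) (hLm : L ord_max = +oo%E)
  (xs : 'I_k.+1 -> 'rV[R]_n) (x : 'rV[R]_n) :
  \sum_(i < k.+1 | i != ord_max)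
      (fine (L i) + mu i) / 2 * dot (x - xs i) (x - xs ord_max)
    + mu ord_max * enorm (x - xs ord_max) ^+ 2
  <= \sum_(i < k.+1 | i != ord_max)
      (fine (L i) - mu i) / 2 * (enorm (x - xs i) * enorm (x - xs ord_max)) ->
  exists f : 'I_k.+1 -> 'rV[R]_n -> \bar R,
      (forall i : 'I_k.+1, classM (mu i) (L i) (xs i) (f i)) /\
      is_minimizer (fun y : 'rV[R]_n => (\sum_(i < k.+1) f i y)%E) x.
Proof.
pose m : 'I_k.+1 := ord_max; pose l i := fine (L i); rewrite -/m => H.
pose e := x - xs m.
have /choice[v vP] := fun i => extremal_direction (x - xs i) e.
pose g i := quad_grad (mu i) (l i) (xs i) (v i) x.
pose h := - (\sum_(i < k.+1 | i != m) g i) - mu m *: e.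
(* This is where the inequality of the hypothesis is used. *)
have h_ge0 : 0 <= dot h e.
  rewrite /h dotDl !dotNl dotZl dot_suml -sqr_enorm.
  rewrite (_ : \sum_(i < k.+1 | i != m) dot (g i) e =
    \sum_(i < k.+1 | i != m) (l i + mu i) / 2 * dot (x - xs i) e -
    \sum_(i < k.+1 | i != m) (l i - mu i) / 2 * (enorm (x - xs i) * enorm e)).
    by move: H; rewrite /l /e; lra.
  rewrite -sumrB; apply: eq_bigr => i _; have [_ vde] := vP i.
  by rewrite [LHS]dotDl !dotZl -mulrA vde; field.
pose F i := if i == m then ramp (mu m) (xs m) x h
  else quad (mu i) (l i) (xs i) (v i).
have lP i : i != m -> [/\ 0 <= mu i, mu i < l i & L i = (l i)%:E].
  move=> im; have [mu0 muL Loo] := hmuL i im.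
  have LE : L i = (l i)%:E.
    by rewrite /l fineK// fin_numElt Loo andbT (lt_trans _ muL)// ltNyr.
  by split=> //; rewrite -lte_fin -LE.
exists (fun i => EFin \o F i); split=> [i|y].
  rewrite /F; case: eqVneq => [->|im]; first by rewrite hLm; exact: ramp_classM.
  have [mu0 mul ->] := lP i im; have [v1 _] := vP i; exact: quad_classM.
rewrite /= !sumEFin lee_fin (bigD1 m)//= [leRHS](bigD1 m)//=.
have Fm : F m = ramp (mu m) (xs m) x h by rewrite /F eqxx.
rewrite Fm.
(* The chosen subgradients of the F i at x sum to zero. *)
have hs := ramp_subgrad (mu m) (xs m) x h y hmum.
have : \sum_(i < k.+1 | i != m) (F i x + dot (g i) (y - x)) <=
    \sum_(i < k.+1 | i != m) F i y.
  apply: ler_sum => i im; rewrite /F (negbTE im).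
  by have [mu0 mul _] := lP i im; exact: quad_subgrad.
rewrite big_split/= -dot_suml.
move: hs; rewrite -/e /h [mu m *: e + _]addrC subrK dotNl; lra.
Qed.

(* m = k.+1; the index m is ord_max : 'I_k.+1, and [m-1] is the set of i != ord_max. *)
Theorem mainTheorem4 (R : realType) (n k : nat)
  (mu : 'I_k.+1 -> R) (L : 'I_k.+1 -> \bar R)
  (hmuL : forall i : 'I_k.+1, i != ord_max ->
     [/\ 0 <= mu i, ((mu i)%:E < L i)%E & (L i < +oo)%E])
  (hmum : 0 <= mu ord_max) (hLm : L ord_max = +oo%E)
  (xs : 'I_k.+1 -> 'rV[R]_n) (x : 'rV[R]_n) :
  (exists f : 'I_k.+1 -> 'rV[R]_n -> \bar R,
      (forall i : 'I_k.+1, classM (mu i) (L i) (xs i) (f i)) /\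
      is_minimizer (fun y : 'rV[R]_n => (\sum_(i < k.+1) f i y)%E) x)
  <->
  \sum_(i < k.+1 | i != ord_max)
      (fine (L i) + mu i) / 2 * dot (x - xs i) (x - xs ord_max)
    + mu ord_max * enorm (x - xs ord_max) ^+ 2
  <= \sum_(i < k.+1 | i != ord_max)
      (fine (L i) - mu i) / 2 * (enorm (x - xs i) * enorm (x - xs ord_max)).
Proof.
split=> [[f [fM xmin]]|]; first exact: minimizer_sum_necessary fM xmin.
exact: minimizer_sum_sufficient.
Qed.
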